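(* Let $A(x)=\sum_{i=0}^n\sigma_iQ_ix^i\in\mathcal Q_{m,n}$ be a matrix polynomial of degree $n$ and let $r_1,\dots,r_q$ denote the radii of the Newton polygon associated with the polynomial $w(x)=\sum_{i=0}^n\sigma_ix^i$. Also, let $k_0,\dots,k_q$ be the abscissas of the vertices of the Newton polygon and set $m_i=k_i-k_{i-1}$. There exist constants $f,g$ such that $12.11<f<12.12$, $4.371<g<4.372$ and \begin{enumerate} \item for $1<i<q$, if $r_{i-1}/r_i<1/f$ and $r_i/r_{i+1}<1/f$, then $A(x)$ has exactly $m\,m_i$ eigenvalues in the annulus $\mathcal A(r_i/g,\,r_ig)$; \item for $i=1$, if $r_i/r_{i+1}<1/f$, then $A(x)$ has exactly $m\,m_i$ eigenvalues in the annulus $\mathcal A(r_i/g',\,r_ig)$, where $g'=2+\sqrt2$; \item for $i=q$, if $r_{i-1}/r_i<1/f$, then $A(x)$ has exactly $m\,m_i$ eigenvalues in the annulus $\mathcal A(r_i/g,\,r_ig')$, where $g'=2+\sqrt2$. \end{enumerate}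
   Context: $\mathcal Q_{m,n}$ is the class of matrix polynomials $A(x)=\sum_{i=0}^nA_ix^i$ with $A_i=\sigma_iQ_i\in\mathbb C^{m\times m}$, $\sigma_i\ge0$, $Q_i^*Q_i=I$, such that $\det A(x)$ is not identically zero, $A_n\ne0$ and $A_0\ne0$. Eigenvalues of $A(x)$ are the roots of $\det A(x)$, counted with multiplicity. $\mathcal A(a,b)=\{x\in\mathbb C:a\le|x|\le b\}$. The Newton polygon of $w(x)=\sum_{i=0}^n\sigma_ix^i$ is the upper part of the convex hull of the points $(i,\log\sigma_i)$, $i=0,\dots,n$ (points with $\sigma_i=0$ are ignored). The abscissas of its vertices are $0=k_0<k_1<\dots<k_q=n$, and its radii are $r_i=(\sigma_{k_{i-1}}/\sigma_{k_i})^{1/(k_i-k_{i-1})}$, $i=1,\dots,q$, so that $r_1<\dots<r_q$ and $-\log r_i$ is the slope of the $i$th edge. Ratios $r_{i-1}/r_i$ and $r_i/r_{i+1}$ are considered only when both radii exist. *)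

(* Defs.v *)
From mathcomp Require Import all_boot all_order all_algebra.
From mathcomp Require Import boolp classical_sets reals exp convex.
From mathcomp.real_closed Require Export complex.

Set Implicit Arguments.
Unset Strict Implicit.
Unset Printing Implicit Defensive.

Import Order.TTheory GRing.Theory Num.Theory.
Local Open Scope ring_scope.
Local Open Scope complex_scope.
Local Open Scope sesquilinear_scope.

Section MatrixPolynomials.
Variables (R : realType) (m n : nat).

Definition matpoly (A : nat -> 'M[R[i]]_m) : 'M[{poly R[i]}]_m :=
  \sum_(i < n.+1) 'X^i *: map_mx polyC (A i).

Definition scaled_coef (sigma : nat -> R) (Q : nat -> 'M[R[i]]_m) (i : nat) :
    'M[R[i]]_m :=
  (sigma i)%:C *: Q i.

(* Only the values of sigma and Q at indices i <= n matter. *)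
Record classQ (sigma : nat -> R) (Q : nat -> 'M[R[i]]_m) : Prop := ClassQ {
  classQ_ge0 : forall i, (i <= n)%N -> 0 <= sigma i;
  classQ_unitary : forall i, (i <= n)%N -> (Q i)^t* *m Q i = 1%:M;
  classQ_regular : \det (matpoly (scaled_coef sigma Q)) != 0;
  classQ_lead : scaled_coef sigma Q n != 0;
  classQ_const : scaled_coef sigma Q 0 != 0 }.

End MatrixPolynomials.

(* The roots of det A(x), each repeated according to its multiplicity
   (meaningful when det A(x) is not the zero polynomial). *)
Definition eigenvalues (R : realType) (m : nat) (A : 'M[{poly R[i]}]_m) :
    seq R[i] :=
  sval (closed_field_poly_normal (\det A)).

Definition annulus (R : realType) (a b : R) : pred R[i] :=
  fun z => a%:C <= `|z| <= b%:C.

Section NewtonPolygon.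
Variables (R : realType) (n : nat) (sigma : nat -> R).

Local Notation plane := (R^o * R^o)%type.

Definition newton_points : set plane :=
  [set p | exists i, [/\ (i <= n)%N, sigma i != 0 & p = (i%:R, ln (sigma i))]].

Definition convex_hull (S : set plane) : set plane :=
  smallest (@convex_set R plane) S.

Definition upper_part (S : set plane) : set plane :=
  [set p | S p /\ forall y, S (p.1, y) -> y <= p.2].

Definition extreme (S : set plane) (p : plane) : Prop :=
  S p /\ forall (a b : plane) (t : R), S a -> S b -> 0 < t < 1 ->
    p = t *: a + (1 - t) *: b -> a = p /\ b = p.

Definition newton_polygon : set plane := upper_part (convex_hull newton_points).

(* The vertices of the upper boundary are the extreme points of the hull that
   lie on it; they are among the points (i, ln (sigma i)). *)
Definition newton_vertex (p : plane) : Prop :=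
  newton_polygon p /\ extreme (convex_hull newton_points) p.

(* The abscissas k_0 < k_1 < ... < k_q of the vertices, in increasing order. *)
Definition newton_abscissas : seq nat :=
  [seq i <- iota 0 n.+1 | `[< exists y : R, newton_vertex (i%:R, y) >]].

Definition newton_k (i : nat) : nat := nth 0%N newton_abscissas i.

Definition newton_q : nat := (size newton_abscissas).-1.

(* The edge length k_i - k_(i-1) and the radius r_i; meaningful for
   1 <= i <= newton_q only. *)
Definition newton_m (i : nat) : nat := (newton_k i - newton_k i.-1)%N.

Definition newton_r (i : nat) : R :=
  (sigma (newton_k i.-1) / sigma (newton_k i)) `^ (newton_m i)%:R^-1.

End NewtonPolygon.

(* Main.v *)
Require Import Defs.
From mathcomp Require Import all_boot all_order all_algebra.
From mathcomp Require Import boolp classical_sets reals exp convex.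
From mathcomp Require Import interval_inference.
From mathcomp Require Import cyclic separable cyclotomic ring lra zify.

(** The number of eigenvalues of modulus less than [rho] is read off a single
    dominant coefficient.  Suppose that
    [sigma k * rho ^+ k > \sum_(i != k) sigma i * rho ^+ i].  After division by
    the invertible matrix [sigma k *: Q k] the matrix polynomial becomes
    [B(x) = x^k (I + F(x))], where [F] is a Laurent polynomial whose operator
    norm is at most some [c < 1] on the circle [|x| = rho], because unitary
    matrices have norm 1.  Hence [det B] has no root on that circle, and by
    Jacobi's formula
    [x (det B)' / det B = m k + tr ((I + F)^-1 x F')
                        = m k + \sum_l (-1)^l tr (F^l x F')].
    Each term of the last sum is, up to the factor [1 / (l + 1)], the Laurent
    polynomial [x (tr F^(l+1))'], whose constant term vanishes.  Averaging over
    [N] equally spaced points of the circle therefore kills every term as soon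
    as [N] is large, while the tail of the series is geometrically small; so the
    average of [x (det B)' / det B] tends to [m k].  On the other hand, the
    average of [x / (x - a)] equals [1 / (1 - (a / rho)^N)], which tends to 1 or
    0 according to whether [a] lies inside or outside the circle; so the same
    average tends to the number of roots inside.  This gives [pellet_unitary], a
    version of Pellet's theorem, without any contour integral.

    The Newton polygon supplies the dominant coefficients.  The line carrying an
    edge lies above all the points [(i, ln (sigma i))] ([newton_edge]), so at a
    vertex [k_i] the terms to the left of [k_i] are bounded by a geometric
    progression of ratio [r_i / rho] and those to the right by one of ratio
    [rho / r_(i+1)] ([newton_dominance]).  On the circles of radii [r_i / g] and
    [r_i * g] these ratios are at most 1/4 on the side of the [i]-th edge and at
    most [g / f <= 3 / 8] on the other one, and 1/3 + 3/5 < 1.  When there is no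
    other side, [g' >= 3] is enough.  The annulus then contains
    [m k_i - m k_(i-1)] eigenvalues. *)

Set Implicit Arguments.
Unset Strict Implicit.
Unset Printing Implicit Defensive.

Import Order.TTheory GRing.Theory Num.Theory.
Local Open Scope ring_scope.
Local Open Scope sesquilinear_scope.

(** * Operator bounds for complex matrices *)

Section OperatorBound.
Variable C : numClosedFieldType.
Implicit Types c d : C.

(** The Euclidean norm of a row vector. *)
Definition rvnorm m (u : 'rV[C]_m) : C := sqrtC (dotmx u u).

(** [opbound c A] says that the operator norm of [A], acting on row vectors by
    right multiplication and relative to the Euclidean norm, is at most [c]. *)
Definition opbound m c (A : 'M[C]_m) : Prop :=
  forall u : 'rV_m, rvnorm (u *m A) <= c * rvnorm u.

Lemma rvnorm_ge0 m (u : 'rV[C]_m) : 0 <= rvnorm u.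
Proof. exact: sqrt_dnorm_ge0. Qed.

Lemma rvnorm_eq0 m (u : 'rV[C]_m) : (rvnorm u == 0) = (u == 0).
Proof. exact: sqrt_dnorm_eq0. Qed.

Lemma rvnormD m (u v : 'rV[C]_m) : rvnorm (u + v) <= rvnorm u + rvnorm v.
Proof. exact: (triangle_lerif (@dotmx C m) u v).1. Qed.

Lemma rvnormZ m (a : C) (u : 'rV[C]_m) : rvnorm (a *: u) = `|a| * rvnorm u.
Proof.
by rewrite /rvnorm dnormZ sqrtCM ?sqrCK// nnegrE ?exprn_ge0// dnorm_ge0.
Qed.

Lemma rvnormN m (u : 'rV[C]_m) : rvnorm (- u) = rvnorm u.
Proof. by rewrite -scaleN1r rvnormZ normrN1 mul1r. Qed.

Lemma normr_le_rvnorm m (u : 'rV[C]_m) i : `|u 0 i| <= rvnorm u.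
Proof.
rewrite -[`|_|]sqrCK // ler_sqrtC ?nnegrE ?exprn_ge0 ?dnorm_ge0//.
rewrite dotmxE mxE (bigD1 i) //= !mxE -normCK lerDl.
by apply: sumr_ge0 => j _; rewrite !mxE -normCK exprn_ge0.
Qed.

Lemma rvnorm_delta m (i : 'I_m) : rvnorm ('e_i : 'rV[C]_m) = 1.
Proof.
rewrite /rvnorm dotmxE mxE (bigD1 i) //= !mxE !eqxx conjC1 mulr1.
rewrite big1 ?addr0 ?sqrtC1// => j ne_ji.
by rewrite !mxE eqxx (negPf ne_ji) mul0r.
Qed.

Lemma opbound_unitary m (U : 'M[C]_m) : U \is unitarymx -> opbound 1 U.
Proof.
move=> /unitarymxP UU u; rewrite mul1r /rvnorm !dotmxE trmx_mul map_mxM mulmxA.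
by rewrite -(mulmxA u) UU mulmx1.
Qed.

Lemma opbound0 m : opbound 0 (0 : 'M[C]_m).
Proof.
by move=> u; rewrite mulmx0 mul0r; have /eqP-> : rvnorm (0 : 'rV[C]_m) == 0
  by rewrite rvnorm_eq0.
Qed.

Lemma opbound1 m : opbound 1 (1%:M : 'M[C]_m).
Proof. by move=> u; rewrite mulmx1 mul1r. Qed.

Lemma opboundD m c d (A B : 'M[C]_m) :
  opbound c A -> opbound d B -> opbound (c + d) (A + B).
Proof.
move=> cA dB u; rewrite mulmxDr mulrDl.
by apply: le_trans (rvnormD _ _) _; apply: lerD.
Qed.

Lemma opbound_sum m I (r : seq I) (P : pred I) (c : I -> C)
    (A : I -> 'M[C]_m) :
  (forall i, P i -> opbound (c i) (A i)) ->
  opbound (\sum_(i <- r | P i) c i) (\sum_(i <- r | P i) A i).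
Proof.
by move=> cA; elim/big_ind2: _ => //; [apply: opbound0 | move=> *; apply: opboundD].
Qed.

Lemma opboundZ m a c (A : 'M[C]_m) : opbound c A -> opbound (`|a| * c) (a *: A).
Proof.
by move=> cA u; rewrite -scalemxAr rvnormZ -mulrA ler_wpM2l.
Qed.

Lemma opboundM m c d (A B : 'M[C]_m) :
  0 <= d -> opbound c A -> opbound d B -> opbound (c * d) (A *m B).
Proof.
move=> d0 cA dB u; rewrite mulmxA; apply: le_trans (dB _) _.
by rewrite (mulrC c) -mulrA ler_wpM2l.
Qed.

Lemma opboundX m c (A : 'M[C]_m) l :
  0 <= c -> opbound c A -> opbound (c ^+ l) (A ^+ l).
Proof.
move=> c0 cA; elim: l => [|l IH]; first exact: opbound1.
by rewrite !exprSr; apply: opboundM.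
Qed.

Lemma normr_mxtrace_le m c (A : 'M[C]_m) : opbound c A -> `|\tr A| <= m%:R * c.
Proof.
move=> cA; rewrite /mxtrace; apply: le_trans (ler_norm_sum _ _ _) _.
rewrite mulr_natl -[m in leRHS]card_ord -sumr_const; apply: ler_sum => i _.
have := cA 'e_i; rewrite rvnorm_delta mulr1 -rowE; apply: le_trans.
by apply: le_trans (normr_le_rvnorm _ i); rewrite mxE.
Qed.

Lemma opbound_add1_unit m c (F : 'M[C]_m) :
  c < 1 -> opbound c F -> 1%:M + F \in unitmx.
Proof.
move=> c1 cF; rewrite -row_free_unit -kermx_eq0; apply/eqP/row_matrixP => i.
rewrite row0; set u := row i _.
have uF : u *m F = - u.
  apply/eqP; rewrite -addr_eq0 addrC -[X in X + _]mulmx1 -mulmxDr.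
  by apply/eqP/sub_kermxP; apply: row_sub.
apply/eqP; rewrite -rvnorm_eq0; have := cF u; rewrite uF rvnormN.
apply: contraTT => nz; have u0 : 0 < rvnorm u by rewrite lt_def nz rvnorm_ge0.
by rewrite -[leLHS]mul1r ler_pM2r // lt_geF.
Qed.

Lemma opbound_invmx_add1 m c (F : 'M[C]_m) :
  c < 1 -> opbound c F -> opbound (1 - c)^-1 (invmx (1%:M + F)).
Proof.
move=> c1 cF u; have unitF := opbound_add1_unit c1 cF.
set X := invmx _; have dc : 0 < 1 - c by rewrite subr_gt0.
rewrite mulrC ler_pdivlMr // mulrC mulrBl mul1r lerBlDr.
have uX : u *m X = u - u *m X *m F.
  apply/eqP; rewrite eq_sym subr_eq -[X in X + _]mulmx1 -mulmxDr -mulmxA.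
  by rewrite mulVmx // mulmx1.
have := rvnormD u (- (u *m X *m F)); rewrite -uX rvnormN => /le_trans; apply.
by rewrite lerD2l; apply: cF.
Qed.

End OperatorBound.

(** * Derivatives of determinants and of traces of powers *)

Section MatrixDerivative.
Variable R : comNzRingType.

(** The entrywise derivative of a matrix of polynomials. *)
Definition dermx m (B : 'M[{poly R}]_m) : 'M[{poly R}]_m := map_mx (@deriv R) B.

Lemma deriv_prod_seq (I : eqType) (r : seq I) (F : I -> {poly R}) :
  uniq r -> (\prod_(i <- r) F i)^`() =
  \sum_(i <- r) (F i)^`() * \prod_(j <- r | j != i) F j.
Proof.
elim: r => [|a r IH] /=; first by rewrite !big_nil -[1]/(1%:P) derivC.
case/andP=> ar ur; rewrite !big_cons derivM IH // eqxx /=.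
congr (_ * _ + _).
  rewrite big_seq_cond [in RHS]big_seq_cond; apply: eq_bigl => j.
  by case: (eqVneq j a) => [->|]; rewrite ?(negPf ar) ?andbT.
rewrite mulr_sumr; apply: eq_big_seq => i ir; rewrite big_cons.
have -> : a != i by apply: contraNneq ar => ->.
by rewrite mulrCA.
Qed.

Lemma deriv_prod (I : finType) (F : I -> {poly R}) :
  (\prod_i F i)^`() = \sum_i (F i)^`() * \prod_(j | j != i) F j.
Proof.
by rewrite deriv_prod_seq ?index_enum_uniq.
Qed.

(** Jacobi's formula. *)
Lemma deriv_det m (B : 'M[{poly R}]_m) :
  (\det B)^`() = \tr (\adj B *m dermx B).
Proof.
(* The determinant of [B] with its [i]-th row differentiated, expanded first
   as a sum over permutations and then along that row. *)
pose Bi i : 'M[{poly R}]_m := \matrix_(a, b) if a == i then (B a b)^`() else B a b.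
transitivity (\sum_i \det (Bi i)).
  rewrite /determinant raddf_sum exchange_big /=; apply: eq_bigr => s _.
  have signE (b : bool) (p : {poly R}) : ((-1) ^+ b * p)^`() = (-1) ^+ b * p^`().
    by case: b; rewrite ?mul1r // !mulN1r derivN.
  rewrite signE.
  rewrite deriv_prod mulr_sumr; apply: eq_bigr => i _; congr (_ * _).
  rewrite [in RHS](bigD1 i) //= mxE eqxx; congr (_ * _).
  by apply: eq_bigr => j ji; rewrite mxE (negPf ji).
rewrite mxtrace_mulC /mxtrace; apply: eq_bigr => i _.
rewrite (expand_det_row _ i) mxE; apply: eq_bigr => j _.
rewrite !mxE eqxx; congr (_ * _); rewrite /cofactor; congr (_ * \det _).
by apply/matrixP => a b; rewrite !mxE eq_sym (negPf (neq_lift _ _)).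
Qed.

Lemma dermxM m (A B : 'M[{poly R}]_m) :
  dermx (A *m B) = dermx A *m B + A *m dermx B.
Proof.
apply/matrixP => i j; rewrite !mxE raddf_sum -big_split; apply: eq_bigr => k _.
by rewrite /= !mxE derivM.
Qed.

Lemma mxtrace_dermx m (A : 'M[{poly R}]_m) : \tr (dermx A) = (\tr A)^`().
Proof. by rewrite /mxtrace raddf_sum; apply: eq_bigr => i _; rewrite mxE. Qed.

Lemma mxtrace_dermx_exp_comm m (E G : 'M[{poly R}]_m) l : E *m G = G *m E ->
  \tr (dermx (E ^+ l.+1) *m G) = \tr (E ^+ l *m dermx E *m G) *+ l.+1.
Proof.
elim: l G => [|l IH] G EG; first by rewrite expr1 expr0 mul1mx mulr1n.
have EGl : E ^+ l.+1 *m G = G *m E ^+ l.+1.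
  have : GRing.comm G (E ^+ l.+1) by apply: commrX; symmetry; exact: EG.
  by move/esym.
have term1 : \tr (dermx E *m E ^+ l.+1 *m G) = \tr (E ^+ l.+1 *m dermx E *m G).
  by rewrite [RHS]mxtrace_mulC mulmxA -EGl mxtrace_mulC -!mulmxA.
have term2 : \tr (E *m dermx (E ^+ l.+1) *m G) =
             \tr (E ^+ l.+1 *m dermx E *m G) *+ l.+1.
  rewrite -(mulmxA E) mxtrace_mulC -(mulmxA (dermx _)) IH; last by rewrite mulmxA EG.
  by congr (_ *+ _); rewrite mulmxA mxtrace_mulC exprS -!mulmxA.
by rewrite [E ^+ l.+2]exprS dermxM mulmxDl mxtraceD term1 term2 -mulrS.
Qed.

(** The trace of a power can be differentiated as if matrices commuted. *)
Lemma deriv_mxtrace_exp m (E : 'M[{poly R}]_m) l :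
  (\tr (E ^+ l.+1))^`() = \tr (E ^+ l *m dermx E) *+ l.+1.
Proof.
rewrite -mxtrace_dermx -[dermx _]mulmx1 mxtrace_dermx_exp_comm ?mulmx1//.
by rewrite mul1mx.
Qed.

End MatrixDerivative.

(** * Averages over roots of unity *)

Section CircleAverage.
Variable C : numClosedFieldType.
Implicit Types (z rho a zeta : C) (f g : C -> C) (S : {poly C}).

Lemma prim_root_exists N : (0 < N)%N -> exists zeta : C, N.-primitive_root zeta.
Proof.
move=> N0; pose p : {poly C} := 'X^N - 1.
have [r Dp] := closed_field_poly_normal p.
rewrite (monicP _) ?monicXnsubC // scale1r in Dp.
have rn1 : all N.-unity_root r by apply/allP=> z; rewrite -root_prod_XsubC -Dp.
have sz_r : (N < (size r).+1)%N.
  by rewrite -(size_prod_XsubC r id) -Dp size_XnsubC.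
have [|z] := hasP (has_prim_root N0 rn1 _ sz_r); last by exists z.
by rewrite -separable_prod_XsubC -Dp separable_Xn_sub_1 // pnatr_eq0 -lt0n.
Qed.

(** The mean value of [f] over the points [rho * zeta ^+ i], [i < N]; when [zeta]
    is a primitive [N]-th root of unity these are [N] equally spaced points of
    the circle of radius [rho]. *)
Definition avg N zeta rho f : C := N%:R^-1 * \sum_(i < N) f (rho * zeta ^+ i).

Lemma avg_sum N zeta rho I (r : seq I) (P : pred I) (f : I -> C -> C) :
  avg N zeta rho (fun z => \sum_(j <- r | P j) f j z) =
  \sum_(j <- r | P j) avg N zeta rho (f j).
Proof. by rewrite /avg exchange_big mulr_sumr. Qed.

Lemma avgD N zeta rho f g :
  avg N zeta rho (fun z => f z + g z) = avg N zeta rho f + avg N zeta rho g.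
Proof. by rewrite /avg big_split mulrDr. Qed.

Lemma avgZ N zeta rho a f :
  avg N zeta rho (fun z => a * f z) = a * avg N zeta rho f.
Proof. by rewrite /avg -mulr_sumr mulrCA. Qed.

Section PrimitiveRoot.
Variables (N : nat) (zeta rho : C).
Hypotheses (prim : N.-primitive_root zeta) (rho0 : 0 < rho).

Let N0 : (0 < N)%N. Proof. exact: prim_order_gt0 prim. Qed.
Let Nn0 : N%:R != 0 :> C. Proof. by rewrite pnatr_eq0 -lt0n. Qed.
Let zeta0 : zeta != 0.
Proof.
apply/eqP => z0; have := prim_expr_order prim; rewrite z0 expr0n gtn_eqF //.
by move/esym/eqP; rewrite oner_eq0.
Qed.

Lemma norm_prim_root i : `|rho * zeta ^+ i| = rho.
Proof.
have z1 : `|zeta| = 1.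
  apply/eqP; rewrite -(@pexpr_eq1 _ _ N) ?normr_ge0 -?lt0n //.
  by rewrite -normrX (prim_expr_order prim) normr1.
by rewrite normrM normrX z1 expr1n mulr1 gtr0_norm.
Qed.

Lemma eq_avg f g : (forall z, `|z| = rho -> f z = g z) ->
  avg N zeta rho f = avg N zeta rho g.
Proof.
by move=> fg; congr (_ * _); apply: eq_bigr => i _; rewrite fg ?norm_prim_root.
Qed.

Lemma avg_cst a : avg N zeta rho (fun=> a) = a.
Proof. by rewrite /avg sumr_const card_ord -[a *+ N]mulr_natl mulKf. Qed.

Lemma norm_avg_le f c : (forall z, `|z| = rho -> `|f z| <= c) ->
  `|avg N zeta rho f| <= c.
Proof.
move=> fc; rewrite /avg normrM normfV normr_nat ler_pdivrMl ?ltr0n //.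
apply: le_trans (ler_norm_sum _ _ _) _.
rewrite mulr_natl -[N in leRHS]card_ord -sumr_const; apply: ler_sum => i _.
by apply: fc; rewrite norm_prim_root.
Qed.

Lemma avg_monomial j K : (j < N)%N -> (K < N)%N ->
  avg N zeta rho (fun z => z ^+ j / z ^+ K) = (j == K)%:R.
Proof.
move=> jN KN; have [->|jK] := eqVneq j K.
  rewrite -[RHS](avg_cst 1); apply: eq_avg => z zr.
  by rewrite divff // expf_eq0 -normr_eq0 zr gt_eqF ?andbF.
pose w := zeta ^+ j / zeta ^+ K.
have w1 : w - 1 != 0.
  rewrite subr_eq0; apply: contra jK => /eqP/(canRL (mulfVK _)).
  rewrite expf_eq0 (negPf zeta0) andbF mul1r => /(_ isT)/eqP.
  by rewrite (eq_prim_root_expr prim) !modn_small.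
have wN : w ^+ N = 1.
  by rewrite expr_div_n !(exprAC _ _ N) (prim_expr_order prim) !expr1n divr1.
rewrite /avg (eq_bigr (fun i : 'I_N => rho ^+ j / rho ^+ K * w ^+ i)) => [|i _].
  rewrite -mulr_sumr -[\sum_(i < N) _](mulKf w1) -subrX1 wN subrr.
  by rewrite !mulr0.
by rewrite /w !exprMn exprVn invfM mulrACA -!(exprAC _ _ i).
Qed.

Lemma avg_horner S K : (size S <= N)%N -> (K < N)%N ->
  avg N zeta rho (fun z => S.[z] / z ^+ K) = S`_K.
Proof.
move=> sN KN.
rewrite (@eq_avg _ (fun z => \sum_(j < N) S`_j * (z ^+ j / z ^+ K))) => [|z _].
  rewrite avg_sum (bigD1 (Ordinal KN)) //= avgZ avg_monomial // eqxx mulr1.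
  rewrite big1 ?addr0 // => j jK; rewrite avgZ avg_monomial //.
  by rewrite -val_eqE /= in jK; rewrite (negPf jK) mulr0.
rewrite (horner_coef_wide _ sN) mulr_suml; apply: eq_bigr => j _.
by rewrite mulrA.
Qed.

(** The mean value of [z / (z - a)], summed as a geometric progression. *)
Lemma avg_pole a : (a / rho) ^+ N != 1 ->
  avg N zeta rho (fun z => z / (z - a)) = (1 - (a / rho) ^+ N)^-1.
Proof.
set w := _ ^+ N => w1; have dw : 1 - w != 0 by rewrite subr_eq0 eq_sym.
have eqf i : rho * zeta ^+ i / (rho * zeta ^+ i - a) =
    (1 - w)^-1 * \sum_(j < N)
      a ^+ j * ((rho * zeta ^+ i) ^+ 0 / (rho * zeta ^+ i) ^+ j).
  set z := rho * _; have z0 : z != 0 by rewrite mulf_neq0 ?expf_neq0 // gt_eqF.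
  have zN : z ^+ N = rho ^+ N.
    by rewrite exprMn exprAC (prim_expr_order prim) expr1n mulr1.
  have azN : (a / z) ^+ N = w by rewrite /w !expr_div_n zN.
  have az : a / z - 1 != 0.
    by apply: contra w1 => /eqP/subr0_eq az1; rewrite -azN az1 expr1n.
  have za : z - a != 0.
    by apply: contra az => /eqP/subr0_eq <-; rewrite divff // subrr.
  rewrite (eq_bigr (fun j : 'I_N => (a / z) ^+ j)) => [|j _]; last first.
    by rewrite expr0 mul1r expr_div_n.
  have -> : \sum_(j < N) (a / z) ^+ j = (1 - w) * (z / (z - a)).
    apply: (mulfI az); rewrite -subrX1 azN; field.
    by rewrite za z0.
  by rewrite mulKf.
rewrite /avg (eq_bigr _ (fun (i : 'I_N) _ => eqf i)) -mulr_sumr mulrCA.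
rewrite exchange_big /= mulr_sumr.
under eq_bigr => j _ do
  rewrite -mulr_sumr mulrCA -/(avg N zeta rho (fun z => z ^+ 0 / z ^+ j))
          avg_monomial //.
rewrite (bigD1 (Ordinal N0)) //= expr0 mul1r big1 ?addr0 ?mulr1 // => j j0.
by rewrite -val_eqE /= eq_sym in j0; rewrite (negPf j0) mulr0.
Qed.

End PrimitiveRoot.
End CircleAverage.

(** * Counting roots in a disc by the logarithmic derivative *)

Section RootCount.
Variable R : realType.
Local Notation C := R[i]%C.
Implicit Types (z rho a w eps : C) (f g : C -> C).

Lemma bernoulli_le (h : R) N : 0 <= h -> 1 + N%:R * h <= (1 + h) ^+ N.
Proof.
move=> h0; elim: N => [|N IH]; first by rewrite mul0r addr0.
rewrite exprS; have := ler_wpM2l (addr_ge0 ler01 h0) IH; apply: le_trans.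
have : 0 <= N%:R * h * h by rewrite !mulr_ge0.
by rewrite -natr1; nra.
Qed.

Lemma real_geometric_small (c eps : R) : 0 <= c < 1 -> 0 < eps ->
  exists N0, forall N, (N0 <= N)%N -> c ^+ N <= eps.
Proof.
case/andP=> c0 c1 eps0; have [->|cn0] := eqVneq c 0.
  by exists 1%N => -[//|N] _; rewrite exprS mul0r ltW.
have cp : 0 < c by rewrite lt_def cn0.
pose h := c^-1 - 1; have hp : 0 < h by rewrite subr_gt0 invf_gt1.
exists (Num.truncn (eps^-1 / h)).+1 => N leN.
rewrite -[c]invrK exprVn -[eps]invrK lef_pV2 ?posrE ?exprn_gt0 ?invr_gt0 //.
have -> : c^-1 = 1 + h by rewrite /h addrC subrK.
apply: le_trans (bernoulli_le N (ltW hp)).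
suff : eps^-1 <= N%:R * h by lra.
rewrite -ler_pdivrMr //; apply: ltW; apply: lt_le_trans (truncnS_gt _) _.
by rewrite ler_nat.
Qed.

Lemma geometric_small (c eps : C) : 0 <= c < 1 -> 0 < eps ->
  exists N0, forall N, (N0 <= N)%N -> c ^+ N <= eps.
Proof.
move=> /andP[c0 c1] eps0.
have cE : c = (complex.Re c)%:C%C by rewrite RRe_real // ger0_real.
have eE : eps = (complex.Re eps)%:C%C by rewrite RRe_real // gtr0_real.
move: c0 c1 eps0; rewrite cE eE => c0 c1 eps0.
rewrite lecR in c0; rewrite ltcR in c1; rewrite ltcR in eps0.
have [|N0 N0P] := @real_geometric_small (complex.Re c) _ _ eps0; first by apply/andP.
by exists N0 => N leN; rewrite -rmorphXn lecR N0P.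
Qed.

(** [avg_cvg rho f l]: the mean values of [f] over [N] equally spaced points of
    the circle of radius [rho] tend to [l] as [N] grows. *)
Definition avg_cvg rho f l : Prop :=
  forall eps, 0 < eps -> exists N0, forall N zeta,
    (N0 <= N)%N -> N.-primitive_root zeta -> `|avg N zeta rho f - l| <= eps.

Lemma avg_cvg_nat_uniq rho f (p q : nat) :
  avg_cvg rho f p%:R -> avg_cvg rho f q%:R -> p = q.
Proof.
move=> fp fq; have e0 : 0 < 3%:R^-1 :> C by rewrite invr_gt0 ltr0n.
have [Np HNp] := fp _ e0; have [Nq HNq] := fq _ e0.
have [zeta prim] := @prim_root_exists C (Np + Nq).+1 isT.
have := lerD (HNp _ _ (leqW (leq_addr _ _)) prim)
             (HNq _ _ (leqW (leq_addl _ _)) prim).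
set m := avg _ _ _ _ => le23.
have : `|p%:R - q%:R| <= 3^-1 + 3^-1 :> C.
  apply: le_trans le23; rewrite (distrC m p%:R) -[X in _ - X](subrK m).
  have -> : p%:R - (q%:R - m + m) = (p%:R - m) + (m - q%:R) :> C by ring.
  exact: ler_normD.
have lt1 : 3^-1 + 3^-1 < 1 :> C.
  have -> : 3^-1 + 3^-1 = 1 - 3^-1 :> C by field.
  by rewrite ltrBlDr ltrDl.
move/le_lt_trans => /(_ _ lt1).
have -> : p%:R - q%:R = (p%:Z - q%:Z)%:~R :> C by rewrite rmorphB.
rewrite -intr_norm -[1]/(1%:~R) ltr_int.
lia.
Qed.

Lemma eq_avg_cvg rho f g l : 0 < rho -> (forall z, `|z| = rho -> f z = g z) ->
  avg_cvg rho f l -> avg_cvg rho g l.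
Proof.
move=> r0 fg fl eps /fl[N0 HN0]; exists N0 => N zeta leN prim.
by rewrite -(eq_avg prim r0 fg) HN0.
Qed.

Lemma avg_cvgD rho f g l l' : avg_cvg rho f l -> avg_cvg rho g l' ->
  avg_cvg rho (fun z => f z + g z) (l + l').
Proof.
move=> fl gl' eps e0; have e20 : 0 < eps / 2 by rewrite divr_gt0 ?ltr0n.
have [Nf Hf] := fl _ e20; have [Ng Hg] := gl' _ e20.
exists (maxn Nf Ng) => N zeta; rewrite geq_max => /andP[lef leg] prim.
rewrite avgD opprD addrACA; apply: le_trans (ler_normD _ _) _.
have -> : eps = eps / 2 + eps / 2 by field.
by apply: lerD; [apply: Hf | apply: Hg].
Qed.

Lemma avg_cvg_cst rho l : avg_cvg rho (fun=> l) l.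
Proof.
move=> eps e0; exists 0 => N zeta _ prim.
by rewrite (avg_cst _ prim) subrr normr0 ltW.
Qed.

Lemma inv1B_small w : `|w| <= 2^-1 -> `|(1 - w)^-1 - 1| <= 2 * `|w|.
Proof.
move=> w2; have lb : 2^-1 <= `|1 - w|.
  apply: le_trans (lerB_normD _ _); rewrite normr1 normrN.
  have -> : 2^-1 = 1 - 2^-1 :> C by field.
  by rewrite lerD2l lerN2.
have nz : 1 - w != 0 by rewrite -normr_gt0 (lt_le_trans _ lb) ?invr_gt0 ?ltr0n.
have -> : (1 - w)^-1 - 1 = (1 - w)^-1 * w by field.
by rewrite normrM normfV ler_wpM2r // -[2]invrK lef_pV2 ?posrE ?normr_gt0 //.
Qed.

Lemma inv1Bexp_cvg w eps : `|w| < 1 -> 0 < eps -> exists N0, forall N,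
  (N0 <= N)%N -> w ^+ N != 1 /\ `|(1 - w ^+ N)^-1 - 1| <= eps.
Proof.
move=> w1 e0; pose e := eps / 2.
have e0' : 0 < e by rewrite divr_gt0 ?ltr0n.
have [|N1 H1] := @geometric_small `|w| _ _ e0'; first by rewrite normr_ge0.
have h0 : 0 < 2^-1 :> C by rewrite invr_gt0 ltr0n.
have [|N2 H2] := @geometric_small `|w| _ _ h0; first by rewrite normr_ge0.
exists (maxn N1 N2) => N; rewrite geq_max => /andP[/H1 le1 /H2 le2].
rewrite -normrX in le1 le2; split.
  apply/eqP => wN; move: le2; rewrite wN normr1 => /le_gtF.
  by rewrite invf_lt1 ?ltr0n // ltr1n.
apply: le_trans (inv1B_small le2) _.
have -> : eps = 2 * e by rewrite /e; field.
by rewrite ler_wpM2l.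
Qed.

(** A simple pole contributes 1 if it lies inside the circle and 0 outside. *)
Lemma avg_cvg_pole rho a : 0 < rho -> `|a| != rho ->
  avg_cvg rho (fun z => z / (z - a)) (`|a| < rho)%R%:R.
Proof.
move=> r0 ar eps e0; set w := a / rho.
have nw : `|w| = `|a| / rho by rewrite normrM normfV (gtr0_norm r0).
have [lt_ar|] := boolP (`|a| < rho).
  have w1 : `|w| < 1 by rewrite nw ltr_pdivrMr // mul1r.
  have [N0 H] := inv1Bexp_cvg w1 e0; exists N0 => N zeta /H[wN le] prim.
  by rewrite avg_pole.
rewrite -real_leNgt ?normr_real ?gtr0_real // => le_ra.
have lt_ra : rho < `|a| by rewrite lt_def ar.
(* Outside the circle, [1 / (1 - w^N) = 1 - 1 / (1 - w^-N)]. *)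
have w0 : w != 0 by rewrite -normr_gt0 nw divr_gt0 // (lt_trans r0).
have v1 : `|w^-1| < 1.
  by rewrite normfV nw invf_div ltr_pdivrMr ?mul1r // (lt_trans r0).
have [N0 H] := inv1Bexp_cvg v1 e0; exists N0 => N zeta /H[vN le] prim.
have wN : w ^+ N != 1 by rewrite -invr_eq1 -exprVn.
rewrite avg_pole // subr0.
have <- : 1 - (1 - w^-1 ^+ N)^-1 = (1 - w ^+ N)^-1.
  rewrite exprVn; have := expf_neq0 N w0; move: vN wN; rewrite exprVn.
  move: (w ^+ N) => x _ x1 x0; have b : x - 1 != 0 by rewrite subr_eq0.
  have b' : 1 - x != 0 by rewrite subr_eq0 eq_sym.
  by field; rewrite b' x0 b.
by rewrite distrC.
Qed.

(** Discrete argument principle: the mean of the logarithmic derivative over a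
    circle counts the roots inside. *)
Lemma avg_cvg_logderiv rho (c : C) (s : seq C) (P : {poly C}) :
  0 < rho -> c != 0 -> P = c *: \prod_(a <- s) ('X - a%:P) ->
  all (fun a => `|a| != rho) s ->
  avg_cvg rho (fun z => z * P^`().[z] / P.[z])
    (count (fun a : C => (`|a| < rho)%R) s)%:R.
Proof.
move=> r0 c0 ->; elim: s c c0 => [|a s IH] c c0 /=.
  move=> _; apply: (eq_avg_cvg r0) (avg_cvg_cst rho 0) => z _.
  by rewrite big_nil alg_polyC derivC horner0 mulr0 mul0r.
case/andP=> ar alls; rewrite natrD.
have pz := avg_cvgD (avg_cvg_pole r0 ar) (IH c c0 alls).
apply: (eq_avg_cvg r0) pz => z zr; rewrite big_cons !derivZ derivM derivXsubC.
set Q := \prod_(_ <- _) _; rewrite mul1r !hornerE.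
have za : z - a != 0.
  by apply: contra ar => /eqP/subr0_eq <-; rewrite zr.
have Qz : Q.[z] != 0.
  apply: contraL alls => Qz; have : root Q z by [].
  rewrite root_prod_XsubC => zs; apply/allPn; exists z => //.
  by rewrite zr eqxx.
by rewrite /=; field; rewrite za c0 Qz.
Qed.

End RootCount.

(** * Pellet's theorem for matrix polynomials with unitary coefficients *)

Section EvaluateMatrix.
Variable C : numClosedFieldType.

(** The value at [z] of a matrix of polynomials. *)
Definition evmx m (z : C) (A : 'M[{poly C}]_m) : 'M[C]_m :=
  map_mx (horner_eval z) A.

Lemma evmxD m z (A B : 'M[{poly C}]_m) : evmx z (A + B) = evmx z A + evmx z B.
Proof. exact: map_mxD. Qed.

Lemma evmxM m z (A B : 'M[{poly C}]_m) :
  evmx z (A *m B) = evmx z A *m evmx z B.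
Proof. exact: map_mxM. Qed.

Lemma evmxX m z (A : 'M[{poly C}]_m) l : evmx z (A ^+ l) = evmx z A ^+ l.
Proof.
elim: l => [|l IH]; first by rewrite !expr0 /evmx map_mx1.
by rewrite !exprS evmxM IH.
Qed.

Lemma evmxZ m z p (A : 'M[{poly C}]_m) : evmx z (p *: A) = p.[z] *: evmx z A.
Proof. exact: map_mxZ. Qed.

Lemma evmx_scalar m z p : evmx z (p%:M : 'M_m) = p.[z]%:M.
Proof. exact: map_scalar_mx. Qed.

Lemma evmx_adj m z (A : 'M[{poly C}]_m) : evmx z (\adj A) = \adj (evmx z A).
Proof. exact: map_mx_adj. Qed.

Lemma horner_det m z (A : 'M[{poly C}]_m) : (\det A).[z] = \det (evmx z A).
Proof. by rewrite /evmx det_map_mx. Qed.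

Lemma horner_mxtrace m z (A : 'M[{poly C}]_m) : (\tr A).[z] = \tr (evmx z A).
Proof. by rewrite /evmx trace_map_mx. Qed.

Lemma matrix_scaleX m (a : C) (A : 'M[C]_m) l : (a *: A) ^+ l = a ^+ l *: A ^+ l.
Proof.
elim: l => [|l IH]; first by rewrite !expr0 scale1r.
rewrite !exprS IH -[_ *: A * _]/(_ *m _) -[A * _]/(_ *m _).
by rewrite -scalemxAl -scalemxAr scalerA.
Qed.

Lemma matrix_oppX m (A : 'M[C]_m) l : (- A) ^+ l = (-1) ^+ l *: A ^+ l.
Proof. by rewrite -scaleN1r matrix_scaleX. Qed.

Lemma geometric_invmx m (F : 'M[C]_m) L : 1%:M + F \in unitmx ->
  invmx (1%:M + F) =
  \sum_(l < L) (- F) ^+ l + (- F) ^+ L *m invmx (1%:M + F).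
Proof.
move=> uF; elim: L => [|L IH]; first by rewrite big_ord0 add0r expr0 mul1mx.
rewrite big_ord_recr /= {1}IH -addrA; congr (_ + _).
rewrite -[X in _ = X + _]mulmx1 -[X in _ *m X + _](mulmxV uF) mulmxA.
rewrite exprSr -mulmxDl; congr (_ *m _).
rewrite -[_ * - F]/(_ *m _) mulmxDr mulmx1 -addrA mulmxN subrr addr0.
by [].
Qed.

End EvaluateMatrix.

Section Dominance.
Variable R : realType.
Local Notation C := R[i]%C.
Variables (m n k : nat) (e : nat -> C) (U : nat -> 'M[C]_m) (rho : C).
Hypotheses (rho0 : 0 < rho) (kn : (k <= n)%N).
Hypotheses (e0 : forall i, (i <= n)%N -> 0 <= e i).
Hypotheses (ek : e k = 1) (Uk : U k = 1%:M).
Hypotheses (uU : forall i, (i <= n)%N -> U i \is unitarymx).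
Hypothesis dom : \sum_(i < n.+1 | i != k :> nat) e i * rho ^+ i < rho ^+ k.

(** The matrix polynomial with coefficients [w i *: U i], [i <= n], restricted to
    the indices satisfying [P]. *)
Local Notation upoly w P :=
  (\sum_(i < n.+1 | P i) 'X^i *: map_mx polyC (w i *: U i)).

Lemma evmx_upoly z (w : nat -> C) (P : pred nat) :
  evmx z (upoly w (fun i : 'I_n.+1 => P i)) =
  \sum_(i < n.+1 | P i) (z ^+ i * w i) *: U i.
Proof.
rewrite /evmx map_mx_sum; apply: eq_bigr => i _.
apply/matrixP => a b; rewrite !mxE.
by rewrite -[LHS]/(_.[z]) hornerM hornerXn hornerC mulrA.
Qed.

Lemma opbound_upoly z (w : nat -> C) (P : pred nat) : `|z| = rho ->
  opbound (\sum_(i < n.+1 | P i) `|w i| * rho ^+ i)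
    (evmx z (upoly w (fun i : 'I_n.+1 => P i))).
Proof.
move=> zr; rewrite evmx_upoly; apply: opbound_sum => i _.
rewrite -zr -normrX -normrM mulrC -[`|_|]mulr1; apply: opboundZ.
by apply: opbound_unitary; apply: uU; rewrite -ltnS.
Qed.

(** The matrix polynomial [B] has the identity as its coefficient of
    [x^k], and [E] gathers its other terms, so that [B(z) = z^k (I + F(z))].
    [H] is [x E' - k E], which makes [z^-k H(z)] equal to [z F'(z)].  On the
    circle of radius [rho], the operator norms of [F] and of [z F'] are at most
    [c < 1] and [h]. *)
Let B : 'M[{poly C}]_m := upoly e xpredT.
Let E : 'M[{poly C}]_m := upoly e (fun i : 'I_n.+1 => i != k :> nat).
Let wH (i : nat) := (i%:R - k%:R) * e i.
Let H : 'M[{poly C}]_m := upoly wH xpredT.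
Let F z := z ^- k *: evmx z E.
Let c := (\sum_(i < n.+1 | i != k :> nat) e i * rho ^+ i) / rho ^+ k.
Let h := (\sum_(i < n.+1) `|wH i| * rho ^+ i) / rho ^+ k.

Lemma B_E : B = ('X^k)%:M + E.
Proof.
have kn1 : (k < n.+1)%N by rewrite ltnS.
rewrite /B (bigD1 (Ordinal kn1)) //= ek Uk scale1r map_mx1 scalemx1.
by congr (_ + _); apply: eq_bigl => i; rewrite -val_eqE.
Qed.

Lemma dermx_upoly (w : nat -> C) (P : pred nat) :
  'X *: dermx (upoly w (fun i : 'I_n.+1 => P i)) =
  upoly (fun i => i%:R * w i) (fun i : 'I_n.+1 => P i).
Proof.
rewrite /dermx map_mx_sum scaler_sumr; apply: eq_bigr => i _.
apply/matrixP => a b; rewrite !mxE -[X in 'X * X]/(deriv _).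
rewrite derivM derivC mulr0 addr0 derivXn mulrA.
case: (nat_of_ord i) => [|j]; first by rewrite mulr0n !mul0r mulr0 mul0r mulr0.
rewrite /= mulrnAr -exprS -[_ *+ j.+1]mulr_natr -!mulrA; congr (_ * _).
by rewrite -polyC_natr -polyCM mulrA.
Qed.

Lemma X_derB : 'X *: dermx B = k%:R%:P *: B + H.
Proof.
rewrite (dermx_upoly e xpredT) /H scaler_sumr -big_split; apply: eq_bigr => i _.
apply/matrixP => a b; rewrite !mxE /wH !polyCM !polyCB.
ring.
Qed.

Lemma X_derE : 'X *: dermx E = k%:R%:P *: E + H.
Proof.
rewrite (dermx_upoly e (fun i => i != k)) /H.
rewrite [X in _ = _ + X](bigID (fun i : 'I_n.+1 => i != k :> nat)) /=.
rewrite [X in _ = _ + (_ + X)]big1 ?addr0 => [|i]; last first.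
  by rewrite negbK => /eqP->; rewrite /wH subrr mul0r scale0r map_mx0 scaler0.
rewrite scaler_sumr -big_split; apply: eq_bigr => i _.
apply/matrixP => a b; rewrite !mxE /wH !polyCM !polyCB.
ring.
Qed.

Let rk0 : 0 < rho ^+ k. Proof. exact: exprn_gt0. Qed.
Let c0 : 0 <= c.
Proof.
rewrite divr_ge0 ?(ltW rk0) //; apply: sumr_ge0 => i _.
by rewrite mulr_ge0 ?exprn_ge0 ?e0 ?(ltW rho0) // -ltnS.
Qed.
Let c1 : c < 1. Proof. by rewrite ltr_pdivrMr // mul1r. Qed.
Let h0 : 0 <= h.
Proof.
rewrite divr_ge0 ?(ltW rk0) //; apply: sumr_ge0 => i _.
by rewrite mulr_ge0 ?exprn_ge0 // (ltW rho0).
Qed.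

Section OnCircle.
Variable z : C.
Hypothesis zr : `|z| = rho.

Let z0 : z != 0. Proof. by rewrite -normr_eq0 zr gt_eqF. Qed.
Let zk0 : z ^+ k != 0. Proof. by rewrite expf_neq0. Qed.

Lemma opboundF : opbound c (F z).
Proof.
have -> : c = `|z ^- k| * \sum_(i < n.+1 | i != k :> nat) `|e i| * rho ^+ i.
  rewrite normfV normrX zr mulrC; congr (_ * _); apply: eq_bigr => i _.
  by rewrite ger0_norm // e0 // -ltnS.
exact/opboundZ/(opbound_upoly e (fun i => i != k) zr).
Qed.

Lemma opboundH : opbound h (z ^- k *: evmx z H).
Proof.
rewrite /h mulrC -zr -normrX -normfV zr.
exact/opboundZ/(opbound_upoly wH xpredT zr).
Qed.

Lemma evmxB : evmx z B = z ^+ k *: (1%:M + F z).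
Proof.
rewrite B_E evmxD scalerDr scalerA mulfV // scale1r; congr (_ + _).
by rewrite evmx_scalar hornerXn scalemx1.
Qed.

Let unitF : 1%:M + F z \in unitmx := opbound_add1_unit c1 opboundF.

Let unitB : evmx z B \in unitmx.
Proof. by rewrite evmxB unitmxZ ?unitfE. Qed.

Lemma det_dominant_neq0 : (\det B).[z] != 0.
Proof. by rewrite horner_det -unitfE -unitmxE. Qed.

(** The logarithmic derivative of [det B], by Jacobi's formula. *)
Lemma logderiv_det : z * (\det B)^`().[z] / (\det B).[z] =
  (m * k)%:R + \tr (invmx (1%:M + F z) *m (z ^- k *: evmx z H)).
Proof.
have nz := det_dominant_neq0.
have XB : z *: evmx z (dermx B) = k%:R *: evmx z B + evmx z H.
  by rewrite -{1}[z]hornerX -evmxZ X_derB evmxD evmxZ hornerC.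
have invB : invmx (1%:M + F z) = z ^+ k *: invmx (evmx z B).
  by rewrite evmxB invmxZ -?evmxB // scalerA mulfV // scale1r.
rewrite invB -scalemxAl -scalemxAr scalerA mulfV // scale1r.
rewrite /invmx unitB -horner_det -scalemxAl mxtraceZ.
rewrite deriv_det horner_mxtrace evmxM evmx_adj.
rewrite -[z * _]mxtraceZ [z *: _]scalemxAr XB mulmxDr mxtraceD -scalemxAr mxtraceZ.
rewrite mul_adj_mx mxtrace_scalar -horner_det -mulr_natl natrM.
by field.
Qed.

(** The first [L] terms of the Neumann series of [(I + F)^-1]. *)
Lemma logderiv_expansion L :
  z * (\det B)^`().[z] / (\det B).[z] =
  (m * k)%:R
  + \sum_(l < L) (-1) ^+ l * ((\tr (E ^+ l *m H)).[z] / z ^+ (k * l.+1))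
  + \tr ((- F z) ^+ L *m invmx (1%:M + F z) *m (z ^- k *: evmx z H)).
Proof.
rewrite logderiv_det {1}(geometric_invmx L unitF) mulmxDl mxtraceD addrA.
congr (_ + _ + _); rewrite mulmx_suml raddf_sum; apply: eq_bigr => l _ /=.
rewrite matrix_oppX -scalemxAl mxtraceZ; congr (_ * _).
rewrite matrix_scaleX -scalemxAl -scalemxAr !mxtraceZ horner_mxtrace evmxM evmxX.
by rewrite mulrCA mulrA -exprS exprVn -exprM mulrC.
Qed.

Lemma logderiv_tail L :
  `|\tr ((- F z) ^+ L *m invmx (1%:M + F z) *m (z ^- k *: evmx z H))| <=
  m%:R * (c ^+ L * (1 - c)^-1 * h).
Proof.
apply: normr_mxtrace_le; apply: opboundM h0 _ opboundH.
apply: opboundM; rewrite ?invr_ge0 ?subr_ge0 ?(ltW c1) //.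
  apply: opboundX => //; have := opboundZ (-1) opboundF.
  by rewrite normrN1 mul1r scaleN1r.
exact: opbound_invmx_add1 opboundF.
Qed.

End OnCircle.

(** The Laurent polynomial [tr (F ^+ l * z F')] is [z (tr F ^+ l.+1)'] divided by
    [l.+1], hence has no constant term. *)
Lemma coef_expansion l : (\tr (E ^+ l *m H))`_(k * l.+1) = 0.
Proof.
have HE : H = 'X *: dermx E - k%:R%:P *: E by rewrite X_derE addrC addKr.
have l0 : l.+1%:R != 0 :> C by rewrite pnatr_eq0.
set T := \tr (E ^+ l.+1).
have trE : \tr (E ^+ l *m H) *+ l.+1 = 'X * T^`() - (k * l.+1)%:R%:P * T.
  rewrite HE mulmxBr raddfB /= -!scalemxAr !mxtraceZ mulrnBl.
  rewrite -[_ *m E]/(_ * E) -exprSr -/T {1}/T deriv_mxtrace_exp mulrnAr.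
  by congr (_ - _); rewrite -mulr_natl !polyC_natr natrM; ring.
apply: (mulfI l0); rewrite mulr0 mulr_natl -coefMn trE.
rewrite coefB coefCM coefXM coef_deriv.
case: (k * _)%N => [|K]; first by rewrite mul0r subrr.
by rewrite /= mulr_natl subrr.
Qed.

(** The same average, computed from the dominant coefficient. *)
Lemma avg_cvg_logderiv_det :
  avg_cvg rho (fun z => z * (\det B)^`().[z] / (\det B).[z]) (m * k)%:R.
Proof.
move=> eps eps0; pose t := m%:R * ((1 - c)^-1 * h).
have t0 : 0 <= t.
  by apply: mulr_ge0 => //; apply: mulr_ge0 => //; rewrite invr_ge0 subr_ge0 ltW.
have t1 : 0 < t + 1 by rewrite ltr_wpDl.
(* The tail is at most [c ^+ L * t]; the other terms average to zero once [N]
   exceeds all the degrees that occur in them. *)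
have [|L /(_ L (leqnn L)) cL] :=
  @geometric_small R c (eps / (t + 1)) _ (divr_gt0 eps0 t1).
  by rewrite c0 c1.
pose S l := \tr (E ^+ l *m H).
pose N0 := (\sum_(l < L) (size (S l) + k * l.+1))%N.
exists N0.+1 => N zeta leN prim.
rewrite (eq_avg prim rho0 (fun z zr => logderiv_expansion zr L)).
rewrite !avgD avg_cst // avg_sum.
rewrite big1 => [|l _]; last first.
  have leN0 : (size (S l) + k * l.+1 <= N0)%N by rewrite /N0 (bigD1 l) //= leq_addr.
  rewrite avgZ avg_horner ?coef_expansion ?mulr0 //.
    by apply: leq_trans (ltnW leN); apply: leq_trans leN0; rewrite leq_addr.
  by apply: leq_trans leN; rewrite ltnS; apply: leq_trans leN0; rewrite leq_addl.
rewrite addr0 addrC addKr.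
apply: le_trans (norm_avg_le prim rho0 (fun z zr => logderiv_tail zr L)) _.
have -> : m%:R * (c ^+ L / (1 - c) * h) = c ^+ L * t by rewrite /t; ring.
apply: le_trans (ler_wpM2r t0 cL) _.
by rewrite mulrAC ler_pdivrMr // ler_pM2l // lerDl.
Qed.

End Dominance.

Section Pellet.
Variable R : realType.
Local Notation C := R[i]%C.

Lemma classQ_unitarymx m n sigma (Q : nat -> 'M[C]_m) i :
  classQ n sigma Q -> (i <= n)%N -> Q i \is unitarymx.
Proof.
by move=> cQ le_in; apply/unitarymxP/mulmx1C/(classQ_unitary cQ).
Qed.

(** Pellet's theorem: if the coefficient of [x^k] dominates on a circle, then no
    eigenvalue lies on it and exactly [m * k] lie inside. *)
Lemma pellet_unitary m n k (sigma : nat -> R) (Q : nat -> 'M[C]_m) (rho : R) :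
  classQ n sigma Q -> (k <= n)%N -> 0 < rho ->
  \sum_(i < n.+1 | i != k :> nat) sigma i * rho ^+ i < sigma k * rho ^+ k ->
  let s := eigenvalues (matpoly n (scaled_coef sigma Q)) in
  all (fun a : C => `|a| != rho%:C%C) s /\
  count (fun a : C => `|a| < rho%:C%C) s = (m * k)%N.
Proof.
move=> cQ kn rho0 dom s; have Q_unitary i := @classQ_unitarymx m n sigma Q i cQ.
have sk0 : 0 < sigma k.
  have sum0 : 0 <= \sum_(i < n.+1 | i != k :> nat) sigma i * rho ^+ i.
    apply: sumr_ge0 => i _; rewrite mulr_ge0 ?exprn_ge0 ?(ltW rho0) //.
    by rewrite (classQ_ge0 cQ) // -ltnS.
  by have := le_lt_trans sum0 dom; rewrite pmulr_lgt0 // exprn_gt0.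
pose e i : C := (sigma i / sigma k)%:C%C.
pose U i := (Q k)^t* *m Q i.
pose B : 'M[{poly C}]_m := \sum_(i < n.+1) 'X^i *: map_mx polyC (e i *: U i).
have skC : (sigma k)%:C%C != 0 :> C by rewrite fmorph_eq0 gt_eqF.
have rC0 : 0 < rho%:C%C :> C by rewrite ltcR.
have e_ge0 i : (i <= n)%N -> 0 <= e i.
  by move=> le_in; rewrite ler0c divr_ge0 ?(ltW sk0) ?(classQ_ge0 cQ).
have ek : e k = 1 by rewrite /e divff ?gt_eqF.
have Uk : U k = 1%:M by apply: (classQ_unitary cQ).
have uU i : (i <= n)%N -> U i \is unitarymx.
  by move=> le_in; rewrite mul_unitarymx ?trmxC_unitary ?Q_unitary.
have domC : \sum_(i < n.+1 | i != k :> nat) e i * rho%:C%C ^+ i < rho%:C%C ^+ k.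
  rewrite -rmorphXn.
  rewrite (eq_bigr (fun i : 'I_n.+1 => (sigma i / sigma k * rho ^+ i)%:C%C)).
    rewrite -rmorph_sum ltcR -(ltr_pM2l sk0) mulr_sumr; apply: le_lt_trans dom.
    rewrite le_eqVlt; apply/orP; left; apply/eqP/eq_bigr => i _.
    by field; rewrite gt_eqF.
  by move=> i _; rewrite rmorphM rmorphXn.
have AB : matpoly n (scaled_coef sigma Q) =
          map_mx polyC ((sigma k)%:C%C *: Q k) *m B.
  rewrite /matpoly /B mulmx_sumr; apply: eq_bigr => i _.
  rewrite -scalemxAr -map_mxM /= /scaled_coef; congr (_ *: map_mx _ _).
  rewrite -scalemxAl -scalemxAr scalerA /U mulmxA.
  rewrite (unitarymxP (Q_unitary _ kn)) mul1mx -rmorphM; congr (_%:C%C *: _).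
  by field; rewrite gt_eqF.
set d := \det ((sigma k)%:C%C *: Q k).
have d0 : d != 0.
  by rewrite -unitfE -unitmxE unitmxZ ?unitfE // unitarymx_unit // Q_unitary.
have detAB : \det (matpoly n (scaled_coef sigma Q)) = d *: \det B.
  by rewrite AB det_mulmx det_map_mx mul_polyC.
have detB : \det B = (lead_coef (\det (matpoly n (scaled_coef sigma Q))) / d) *:
                     \prod_(a <- s) ('X - a%:P).
  apply: (scalerI d0); rewrite -detAB scalerA mulrC divfK //.
  by rewrite /s /eigenvalues; case: closed_field_poly_normal.
have lead0 : lead_coef (\det (matpoly n (scaled_coef sigma Q))) / d != 0.
  by rewrite mulf_neq0 ?invr_eq0 ?lead_coef_eq0 ?(classQ_regular cQ).
have alls : all (fun a : C => `|a| != rho%:C%C) s.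
  apply/allP => a sa; apply/eqP => ar.
  have /negP := det_dominant_neq0 rC0 kn e_ge0 ek Uk uU domC ar; apply.
  by rewrite -/B detB hornerZ mulf_eq0 -/(root _ _) root_prod_XsubC sa orbT.
split=> //; apply: (@avg_cvg_nat_uniq R rho%:C%C).
  exact: avg_cvg_logderiv rC0 lead0 detB alls.
exact: avg_cvg_logderiv_det rC0 kn e_ge0 ek Uk uU domC.
Qed.

End Pellet.

(** * The Newton polygon *)

Section ConvexPlane.
Variable R : realType.
Local Notation plane := (R^o * R^o)%type.
Implicit Types (p a b : plane) (S A : set plane).

Lemma convex_setP A : convex_set A <->
  (forall a b (t : R), A a -> A b -> 0 < t < 1 -> A (t *: a + (1 - t) *: b)).
Proof.
split=> [cA a b t Aa Ab /andP[t0 t1]|cA].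
  exact: set_mem (cA a b (Itv01 (ltW t0) (ltW t1)) (mem_set Aa) (mem_set Ab)).
apply/convex_setW => a b /set_mem Aa /set_mem Ab l l0 l1; apply/mem_set.
by apply: (cA a b l%:num) => //; rewrite l0.
Qed.

Lemma convex_hull_convex S : convex_set (convex_hull S).
Proof.
apply/convex_setP => a b t Sa Sb t01 A [cA SA].
by move/convex_setP: (cA); apply; [apply: Sa | apply: Sb |].
Qed.

Lemma convex_hull_sub S A :
  convex_set A -> (S `<=` A)%classic -> (convex_hull S `<=` A)%classic.
Proof. exact: smallest_sub. Qed.

(** An extreme point of a convex hull is one of the generating points: deleting
    an extreme point from a convex set leaves a convex set. *)
Lemma extreme_convex_hull S p : extreme (convex_hull S) p -> S p.
Proof.
case=> hp ext; apply: contrapT => nSp.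
pose A : set plane := [set a | convex_hull S a /\ a <> p]%classic.
have cA : convex_set A.
  apply/convex_setP => a b t [ha ap] [hb bp] t01; split.
    by have /convex_setP := @convex_hull_convex S; apply.
  by move=> /esym /(ext _ _ _ ha hb t01) [].
have SA : (S `<=` A)%classic.
  by move=> a Sa; split; [apply: sub_gen_smallest | move=> ap; rewrite -ap in nSp].
by have [] := convex_hull_sub cA SA hp.
Qed.

(** Affine functionals of the plane. *)
Definition affine (phi : plane -> R) : Prop := forall a b (t : R),
  phi (t *: a + (1 - t) *: b) = t * phi a + (1 - t) * phi b.

(** Lexicographic half-plane: the points at which [(phi, psi)] is at most
    [(0, 0)] in the lexicographic order. *)
Definition lexle0 (phi psi : plane -> R) : set plane :=
  [set p | phi p < 0 \/ phi p = 0 /\ psi p <= 0]%classic.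

Lemma convex_lexle0 phi psi : affine phi -> affine psi ->
  convex_set (lexle0 phi psi).
Proof.
move=> aphi apsi; apply/convex_setP => a b t la lb /andP[t0 t1].
rewrite /lexle0 /= aphi apsi; have s0 : 0 < 1 - t by rewrite subr_gt0.
case: la => [a0|[a0 a'0]]; case: lb => [b0|[b0 b'0]].
- by left; nra.
- by left; rewrite b0; nra.
- by left; rewrite a0; nra.
- by right; rewrite a0 b0; split; [ring | nra].
Qed.

(** The only point at which both functionals vanish is extreme. *)
Lemma lexle0_extreme phi psi p a b t : affine phi -> affine psi ->
  (forall c, phi c = 0 -> psi c = 0 -> c = p) -> phi p = 0 -> psi p = 0 ->
  lexle0 phi psi a -> lexle0 phi psi b -> 0 < t < 1 ->
  p = t *: a + (1 - t) *: b -> a = p /\ b = p.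
Proof.
move=> aphi apsi uniq phip psip la lb /andP[t0 t1] pE.
have := aphi a b t; have := apsi a b t; rewrite -pE phip psip => psi0 phi0.
have s0 : 0 < 1 - t by rewrite subr_gt0.
case: la => [a0|[a0 a'0]]; case: lb => [b0|[b0 b'0]].
- by exfalso; nra.
- by exfalso; nra.
- by exfalso; nra.
have a'E : psi a = 0 by apply: le_anti; apply/andP; split=> //; nra.
have b'E : psi b = 0 by apply: le_anti; apply/andP; split=> //; nra.
by split; apply: uniq.
Qed.

End ConvexPlane.

Section NewtonEdges.
Variables (R : realType) (n : nat) (sigma : nat -> R).
Local Notation plane := (R^o * R^o)%type.
Local Notation L i := (ln (sigma i)).
Local Notation hull := (convex_hull (newton_points n sigma)).
Local Notation V := (newton_abscissas n sigma).

Let pt (i : nat) : plane := (i%:R, L i).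

Lemma pt_hull i : (i <= n)%N -> sigma i != 0 -> hull (pt i).
Proof. by move=> le_in si; apply: sub_gen_smallest; exists i. Qed.

(** The Newton diagram consists of the points [(i, ln (sigma i))] with
    [sigma i != 0].  One of them that is the unique maximum of a lexicographic
    pair of affine functionals, and the highest point of the half-plane at its
    abscissa, is a vertex. *)
Lemma lexle0_vertex (phi psi : plane -> R) k : affine phi -> affine psi ->
  (forall c, phi c = 0 -> psi c = 0 -> c = pt k) ->
  phi (pt k) = 0 -> psi (pt k) = 0 ->
  (forall y, lexle0 phi psi (k%:R, y) -> y <= L k) ->
  (k <= n)%N -> sigma k != 0 ->
  (forall i, (i <= n)%N -> sigma i != 0 -> lexle0 phi psi (pt i)) ->
  k \in V.
Proof.
move=> aphi apsi uniq phik psik upk kn sk below.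
have sub : (hull `<=` lexle0 phi psi)%classic.
  apply: convex_hull_sub; first exact: convex_lexle0.
  by move=> _ [i [le_in si ->]]; apply: below.
rewrite mem_filter mem_iota leq0n ltnS kn !andbT; apply/asboolP; exists (L k).
split; split; first exact: pt_hull.
- by move=> y /sub; apply: upk.
- exact: pt_hull.
- move=> a b t /sub la /sub lb t01.
  exact: (lexle0_extreme aphi apsi uniq phik psik la lb t01).
Qed.

(** The chord joining two points of the diagram on either side of a vertex passes
    strictly below that vertex. *)
Lemma vertexP c : c \in V -> [/\ (c <= n)%N, sigma c != 0 &
  forall j l, (j < c < l)%N -> (l <= n)%N -> sigma j != 0 -> sigma l != 0 ->
  (L j - L c) * (l - c)%:R + (L l - L c) * (c - j)%:R < 0].
Proof.
rewrite mem_filter mem_iota ltnS => /andP[/asboolP[y [[hy upy] ext]] cn].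
have [i [le_in si [ci yE]]] := extreme_convex_hull ext.
have ? : c = i by apply/eqP; rewrite -(@eqr_nat R) ci.
subst i; split => // j l /andP[jc cl] le_ln sj sl.
have jn : (j <= n)%N by apply: leq_trans (ltnW jc) cn.
(* Otherwise the chord from [j] to [l] passes through the vertex or above it. *)
pose t : R := (l - c)%:R / (l - j)%:R.
have d1 : 0 < (l - c)%:R :> R by rewrite ltr0n subn_gt0.
have d2 : 0 < (c - j)%:R :> R by rewrite ltr0n subn_gt0.
have dE : (l - j)%:R = (l - c)%:R + (c - j)%:R :> R.
  by rewrite -natrD; congr _%:R; lia.
have d3 : 0 < (l - j)%:R :> R by rewrite dE addr_gt0.
have t01 : 0 < t < 1.
  by rewrite divr_gt0 //= ltr_pdivrMr // mul1r dE ltrDl.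
have tE : 1 - t = (c - j)%:R / (l - j)%:R.
  by rewrite /t dE; field; rewrite -dE gt_eqF.
have xE : t * j%:R + (1 - t) * l%:R = c%:R.
  have lE : l%:R = j%:R + (l - j)%:R :> R by rewrite -natrD; congr _%:R; lia.
  have cE : c%:R = j%:R + (c - j)%:R :> R by rewrite -natrD; congr _%:R; lia.
  by rewrite lE cE tE /t dE; field; rewrite -dE gt_eqF.
have chord : hull (c%:R, t * L j + (1 - t) * L l).
  have /convex_setP /(_ (pt j) (pt l) t) :=
    @convex_hull_convex R (newton_points n sigma).
  have -> : t *: pt j + (1 - t) *: pt l = (c%:R, t * L j + (1 - t) * L l).
    by rewrite -xE.
  by apply=> //; apply: pt_hull.
have := upy _ chord; rewrite /= yE le_eqVlt => /orP[/eqP eq|lt].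
  have [] := ext.2 (pt j) (pt l) t (pt_hull jn sj) (pt_hull le_ln sl) t01.
    by rewrite yE -eq -xE.
  by case=> /eqP; rewrite eqr_nat (ltn_eqF jc).
have d4 : 0 < (l - j)%:R^-1 :> R by rewrite invr_gt0.
rewrite -(pmulr_llt0 _ d4).
have -> : ((L j - L c) * (l - c)%:R + (L l - L c) * (c - j)%:R) * (l - j)%:R^-1
        = t * L j + (1 - t) * L l - L c.
  by rewrite tE /t dE; field; rewrite -dE gt_eqF.
by rewrite subr_lt0.
Qed.

Lemma affine_line (s x0 y0 : R) :
  affine (fun p : plane => p.2 - (y0 + s * (p.1 - x0))).
Proof. by move=> [a1 a2] [b1 b2] t /=; rewrite /GRing.scale /=; ring. Qed.

Lemma affine_abscissa (x0 : R) : affine (fun p : plane => p.1 - x0).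
Proof. by move=> [a1 a2] [b1 b2] t /=; rewrite /GRing.scale /=; ring. Qed.

Lemma affine_opp_abscissa : affine (fun p : plane => - p.1).
Proof. by move=> [a1 a2] [b1 b2] t /=; rewrite /GRing.scale /=; ring. Qed.

Lemma affine_ordinate (y0 : R) : affine (fun p : plane => p.2 - y0).
Proof. by move=> [a1 a2] [b1 b2] t /=; rewrite /GRing.scale /=; ring. Qed.

Hypotheses (s0 : sigma 0 != 0) (sn : sigma n != 0).

(** The leftmost point is a vertex: it maximizes [(- x, y)]. *)
Lemma vertex0 : 0%N \in V.
Proof.
apply: (lexle0_vertex affine_opp_abscissa (affine_ordinate (L 0))) => //=.
- by move=> [x y] /= x0 y0; congr (_, _); lra.
- by rewrite oppr0.
- by rewrite subrr.
- by move=> y [|[_]] /=; rewrite ?oppr0 ?ltxx // subr_le0.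
- move=> [|i] _ _; first by right; rewrite /= oppr0 subrr.
  by left; rewrite /= oppr_lt0 ltr0n.
Qed.

(** Every vertex other than the last is the left end of an edge: the line of
    largest slope through it and a point to its right dominates the diagram and
    passes through the next vertex. *)
Lemma next_vertex a : a \in V -> (a < n)%N -> exists b s,
  [/\ (a < b)%N, b \in V, (forall c, c \in V -> ~~ (a < c < b)%N),
      L b = L a + s * (b%:R - a%:R) &
      forall j, (j <= n)%N -> sigma j != 0 -> L j <= L a + s * (j%:R - a%:R)].
Proof.
move=> aV lt_an; have [le_an sa vert] := vertexP aV.
pose P := [pred j : 'I_n.+1 | (a < j)%N && (sigma j != 0)].
pose slope (j : nat) : R := (L j - L a) / (j%:R - a%:R).
have Pn : P ord_max by rewrite /P /= lt_an sn.
(* [s] is the largest slope, and [b] the last index at which it is reached. *)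
case: (arg_maxP (fun j : 'I_n.+1 => slope j) Pn) => j0 /andP[/= aj0 sj0] maxj0.
pose s := slope j0.
pose P' := [pred j : 'I_n.+1 | P j && (slope j == s)].
have Pj0 : P' j0 by rewrite /P' /P /= aj0 sj0 eqxx.
case: (arg_maxnP (fun j : 'I_n.+1 => val j) Pj0) =>
  b /andP[/andP[/= ab sb] /eqP slb] maxb.
have diff j : (a < j)%N -> 0 < j%:R - a%:R :> R.
  by move=> aj; rewrite subr_gt0 ltr_nat.
have LE j : (a < j)%N -> L j = L a + slope j * (j%:R - a%:R).
  by move=> aj; rewrite /slope divfK ?gt_eqF ?diff // addrC subrK.
have Lb : L b = L a + s * (b%:R - a%:R) by rewrite LE // slb.
have bn : (b <= n)%N by rewrite -ltnS.
have right j : (a < j)%N -> (j <= n)%N -> sigma j != 0 -> slope j <= s.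
  move=> aj jn sj; have jn1 : (j < n.+1)%N by rewrite ltnS.
  by apply: (maxj0 (Ordinal jn1)); rewrite /P /= aj sj.
have dom j : (j <= n)%N -> sigma j != 0 -> L j <= L a + s * (j%:R - a%:R).
  move=> jn sj; case: (ltngtP j a) => [ja|aj|->].
  - have := vert j b; rewrite ja ab => /(_ isT bn sj sb).
    rewrite !natrB ?(ltnW ja) ?(ltnW ab) // Lb.
    have := diff _ ab; move: (_%:R - _%:R) (L j) => d Lj d0.
    move=> H; have : (Lj - L a + s * (a%:R - j%:R)) * d < 0 by nra.
    by rewrite pmulr_llt0 //; nra.
  - by rewrite {1}LE // lerD2l ler_pM2r ?diff ?right.
  - by rewrite subrr mulr0 addr0.
have strict j : (j <= n)%N -> sigma j != 0 -> (b < j)%N ->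
    L j < L a + s * (j%:R - a%:R).
  move=> jn sj bj; have aj := ltn_trans ab bj.
  rewrite {1}LE // ltrD2l ltr_pM2r ?diff // lt_neqAle right // andbT.
  apply: contraL bj => slj; rewrite -leqNgt; have jn1 : (j < n.+1)%N by rewrite ltnS.
  by apply: (maxb (Ordinal jn1)); rewrite /P' /P /= aj sj.
exists b, s; split => //.
  (* [b] is the abscissa of the rightmost point of the diagram on the line. *)
  apply: (lexle0_vertex (affine_line s a%:R (L a)) (affine_abscissa b%:R)) => //=.
  - move=> [x y] /= y0 x0; have xb : x = b%:R by lra.
    by rewrite /pt Lb; congr (_, _) => //; rewrite -xb; lra.
  - by rewrite Lb; ring.
  - by rewrite subrr.
  - by move=> y [|[]] /= H; rewrite Lb; lra.
  - move=> j jn sj; case: (leqP j b) => jb.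
      have := dom j jn sj; rewrite le_eqVlt => /orP[/eqP eq|lt].
        by right; split; rewrite /= ?eq ?subrr // subr_le0 ler_nat.
      by left; rewrite /= subr_lt0.
    by left; rewrite /= subr_lt0 strict.
move=> c cV; apply/negP => /andP[ac cb].
have [cn sc vertc] := vertexP cV; have := vertc a b; rewrite ac cb.
move=> /(_ isT bn sa sb); have := dom c cn sc.
rewrite !natrB ?(ltnW ac) ?(ltnW cb) // Lb.
have d1 : 0 < c%:R - a%:R :> R by exact: diff.
have d2 : 0 < b%:R - c%:R :> R by rewrite subr_gt0 ltr_nat.
by nra.
Qed.

Lemma newton_abscissas_sorted : sorted ltn V.
Proof. by apply: sorted_filter; [apply: ltn_trans | apply: iota_ltn_sorted]. Qed.

End NewtonEdges.

Section NewtonRadii.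
Variables (R : realType) (n : nat) (sigma : nat -> R).
Hypotheses (sge0 : forall i, (i <= n)%N -> 0 <= sigma i).
Hypotheses (s0 : sigma 0 != 0) (sn : sigma n != 0).
Local Notation V := (newton_abscissas n sigma).
Local Notation k_ := (newton_k n sigma).
Local Notation q := (newton_q n sigma).
Local Notation r_ := (newton_r n sigma).

Lemma size_newton_abscissas : size V = q.+1.
Proof. by rewrite prednK //; case: V (vertex0 n s0). Qed.

Lemma newton_k_mem i : (i <= q)%N -> k_ i \in V.
Proof. by move=> iq; rewrite mem_nth // size_newton_abscissas. Qed.

Lemma newton_k_index c : c \in V -> exists2 i, (i <= q)%N & c = k_ i.
Proof.
move=> cV; exists (index c V).
  by rewrite -ltnS -size_newton_abscissas index_mem.
by rewrite /newton_k nth_index.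
Qed.

Lemma newton_k_lt i j : (i < j)%N -> (j <= q)%N -> (k_ i < k_ j)%N.
Proof.
move=> ij jq; have sV := newton_abscissas_sorted n sigma.
by apply: (sorted_ltn_nth ltn_trans 0%N sV) => //;
  rewrite inE size_newton_abscissas ltnS // ltnW // (leq_trans ij).
Qed.

Lemma newton_k_ltE i j : (i <= q)%N -> (j <= q)%N -> (k_ i < k_ j)%N = (i < j)%N.
Proof.
move=> iq jq; case: (ltngtP i j) => [ij|ji|->]; last by rewrite ltnn.
- by rewrite newton_k_lt.
- by apply/negbTE; rewrite -leqNgt ltnW // newton_k_lt.
Qed.

Lemma newton_k0 : k_ 0 = 0%N.
Proof.
have [i iq e0] := newton_k_index (vertex0 n s0).
case: i iq e0 => [//|i] iq e0.
by have := @newton_k_lt 0 i.+1 isT iq; rewrite -e0.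
Qed.

Lemma newton_kq : k_ q = n.
Proof.
have kV := newton_k_mem (leqnn q); have [kn _ _] := vertexP kV.
apply/eqP; rewrite eqn_leq kn leqNgt; apply/negP => lt_kn.
have [b [s [kb bV _ _ _]]] := next_vertex sn kV lt_kn.
have [j jq bE] := newton_k_index bV.
by move: kb; rewrite bE newton_k_ltE // ltnNge jq.
Qed.

(** The line carrying the [i]-th edge dominates the Newton diagram; the two bounds
    on [sigma j] measure from the right and from the left end of the edge. *)
Lemma newton_edge i : (0 < i <= q)%N ->
  [/\ (k_ i.-1 < k_ i <= n)%N, 0 < r_ i, 0 < sigma (k_ i) &
   forall j, (j <= n)%N ->
     ((j <= k_ i)%N -> sigma j <= sigma (k_ i) * r_ i ^+ (k_ i - j)) /\
     ((k_ i.-1 <= j)%N -> sigma j * r_ i ^+ (j - k_ i.-1) <= sigma (k_ i.-1))].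
Proof.
case/andP=> i0 iq; have i1q : (i.-1 <= q)%N by rewrite (leq_trans (leq_pred i)).
have lt_ab : (k_ i.-1 < k_ i)%N by rewrite newton_k_lt // prednK.
rewrite /newton_r /newton_m; have bV := newton_k_mem iq; move: lt_ab bV.
have gapV c : c \in V -> ~~ (k_ i.-1 < c < k_ i)%N.
  case/newton_k_index=> j jq ->; rewrite !newton_k_ltE //; lia.
have aV := newton_k_mem i1q; move: aV gapV.
move: (k_ i.-1) (k_ i) => a b aV gapV lt_ab bV.
have [bn sb _] := vertexP bV; have [an sa _] := vertexP aV.
have [b' [s [ab' bV' gap' Lb dom]]] := next_vertex sn aV (leq_trans lt_ab bn).
have bb' : b' = b.
  move: (gapV b' bV') (gap' b bV); rewrite lt_ab ab' /= -!leqNgt => l1 l2.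
  by apply/eqP; rewrite eqn_leq l2 l1.
subst b'; have sa0 : 0 < sigma a by rewrite lt_def sa sge0.
have sb0 : 0 < sigma b by rewrite lt_def sb sge0.
set r := powR _ _; have r0 : 0 < r by rewrite powR_gt0 // divr_gt0.
have d0 : 0 < (b - a)%:R :> R by rewrite ltr0n subn_gt0.
have lnr : ln r = - s.
  rewrite /r ln_powR lnM ?posrE ?invr_gt0 // lnV ?posrE // Lb.
  by rewrite -natrB ?(ltnW lt_ab) //; field; rewrite gt_eqF.
split => //; first by rewrite lt_ab.
move=> j jn; have [->|sj] := eqVneq (sigma j) 0.
  by split=> _; rewrite ?mul0r ?mulr_ge0 ?exprn_ge0 ?(ltW sb0) ?(ltW r0) ?(ltW sa0).
have sj0 : 0 < sigma j by rewrite lt_def sj sge0.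
have domj := dom j jn sj; split=> jab.
  rewrite -ler_ln ?posrE ?mulr_gt0 ?exprn_gt0 //.
  rewrite lnM ?posrE ?exprn_gt0 // lnXn // lnr -mulr_natl natrB // Lb.
  by apply: le_trans domj _; rewrite le_eqVlt; apply/orP; left; apply/eqP; ring.
rewrite -ler_ln ?posrE ?mulr_gt0 ?exprn_gt0 //.
by rewrite lnM ?posrE ?exprn_gt0 // lnXn // lnr -mulr_natl natrB //; lra.
Qed.

End NewtonRadii.

(** * Annuli separating the eigenvalues *)

Section GeometricDominance.
Variable R : realFieldType.

Lemma sum_geometric_left (u : R) k : 0 <= u < 1 ->
  \sum_(0 <= i < k) u ^+ (k - i) <= u / (1 - u).
Proof.
case/andP=> u0 u1; have d0 : 0 < 1 - u by rewrite subr_gt0.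
elim: k => [|k IH]; first by rewrite big_nil divr_ge0 // ltW.
rewrite big_nat_recr //= subSnn expr1.
rewrite (@eq_big_nat _ _ _ _ _ _ (fun i => u * u ^+ (k - i))) => [|i ik]; last first.
  by rewrite -exprS subSn // ltnW.
rewrite -mulr_sumr; have := ler_wpM2l u0 IH.
have e : u / (1 - u) = u * (u / (1 - u)) + u by field; rewrite gt_eqF.
by move=> le_u; rewrite [leRHS]e lerD2r.
Qed.

Lemma sum_geometric_right (v : R) k n : 0 <= v < 1 ->
  \sum_(k.+1 <= i < n.+1) v ^+ (i - k) <= v / (1 - v).
Proof.
move=> v01; rewrite -{1}[k.+1]add0n big_addn.
rewrite (eq_bigr (fun i => v ^+ i.+1)) => [|i _]; last first.
  by rewrite addnS subSn ?leq_addl // addnK.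
rewrite big_nat_rev /= add0n.
rewrite (@eq_big_nat _ _ _ _ _ _ (fun i => v ^+ (n.+1 - k.+1 - i))) => [|i ik].
  exact: sum_geometric_left.
by congr (_ ^+ _); lia.
Qed.

(** The condition on [u] and [v] is [u / (1 - u) + v / (1 - v) < 1]. *)
Lemma geometric_dominance n k (x : nat -> R) (u v : R) :
  (k <= n)%N -> 0 < x k -> 0 <= u < 1 -> 0 <= v < 1 ->
  u * (1 - v) + v * (1 - u) < (1 - u) * (1 - v) ->
  (forall j, (j < k)%N -> x j <= x k * u ^+ (k - j)) ->
  (forall j, (k < j <= n)%N -> x j <= x k * v ^+ (j - k)) ->
  \sum_(i < n.+1 | i != k :> nat) x i < x k.
Proof.
move=> kn xk u01 v01 uv1 xl xr.
rewrite -(big_mkord (fun i => i != k) x).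
rewrite (@big_cat_nat _ _ _ k) //=; last by rewrite leqW.
rewrite [X in _ + X]big_ltn_cond ?ltnS // eqxx /=.
have left_le : \sum_(0 <= i < k | i != k) x i <= x k * (u / (1 - u)).
  apply: le_trans (ler_wpM2l (ltW xk) (sum_geometric_left k u01)).
  rewrite mulr_sumr big_nat_cond [leRHS]big_nat_cond.
  rewrite (eq_bigl (fun i => (0 <= i < k)%N && true)).
    by apply: ler_sum => i; rewrite andbT => /andP[_ ik]; apply: xl.
  by move=> i; case: (ltngtP i k); rewrite ?andbF.
have right_le : \sum_(k.+1 <= i < n.+1 | i != k) x i <= x k * (v / (1 - v)).
  apply: le_trans (ler_wpM2l (ltW xk) (sum_geometric_right k n v01)).
  rewrite mulr_sumr big_nat_cond [leRHS]big_nat_cond.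
  rewrite (eq_bigl (fun i => (k < i < n.+1)%N && true)).
    by apply: ler_sum => i; rewrite andbT => ik; apply: xr.
  by move=> i; case: (ltngtP k i); rewrite ?andbF.
apply: le_lt_trans (lerD left_le right_le) _.
rewrite -mulrDr -[ltRHS]mulr1 ltr_pM2l //.
have u0 : 0 < 1 - u by case/andP: u01; rewrite subr_gt0.
have v0 : 0 < 1 - v by case/andP: v01; rewrite subr_gt0.
have -> : u / (1 - u) + v / (1 - v) =
          (u * (1 - v) + v * (1 - u)) / ((1 - u) * (1 - v)).
  by field; rewrite !gt_eqF.
by rewrite ltr_pdivrMr ?mul1r // mulr_gt0.
Qed.

End GeometricDominance.

Section Annuli.
Variable R : realType.
Local Notation C := R[i]%C.

Lemma count_annulus (a b : R) (s : seq C) : a < b ->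
  all (fun z : C => `|z| != b%:C%C) s ->
  (count (fun z : C => `|z| < a%:C%C)%R s + count (annulus a b) s)%N =
  count (fun z : C => `|z| < b%:C%C)%R s.
Proof.
move=> ab; elim: s => [//|z s IH] /= /andP[zb /IH <-].
rewrite addnACA; congr addn; move: zb; rewrite /annulus.
rewrite -[`|z|]RRe_real ?normr_real // !lecR !ltcR; set x := complex.Re _.
rewrite (inj_eq (@complexI R)) => xb; rewrite [x < b]lt_neqAle xb /=.
case: (ltP x a) => [xa|_] /=; last by rewrite add0n.
by rewrite (ltW (lt_trans xa ab)).
Qed.

Lemma classQ_sigma0 m n (sigma : nat -> R) (Q : nat -> 'M[C]_m) :
  classQ n sigma Q -> sigma 0%N != 0.
Proof.
move=> cQ; apply: contraNneq (classQ_const cQ) => s0.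
by rewrite /scaled_coef s0 rmorph0 scale0r.
Qed.

Lemma classQ_sigman m n (sigma : nat -> R) (Q : nat -> 'M[C]_m) :
  classQ n sigma Q -> sigma n != 0.
Proof.
move=> cQ; apply: contraNneq (classQ_lead cQ) => sn.
by rewrite /scaled_coef sn rmorph0 scale0r.
Qed.

Variables (m n : nat) (sigma : nat -> R) (Q : nat -> 'M[C]_m).
Hypothesis cQ : classQ n sigma Q.
Local Notation k_ := (newton_k n sigma).
Local Notation q := (newton_q n sigma).
Local Notation r_ := (newton_r n sigma).
Local Notation eigs := (eigenvalues (matpoly n (scaled_coef sigma Q))).

Let s0 := classQ_sigma0 cQ.
Let sn := classQ_sigman cQ.
Let edge := newton_edge (classQ_ge0 cQ) s0 sn.

(** The coefficient at a vertex dominates on a circle whose radius is well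
    separated from those of the adjacent edges. *)
Lemma newton_dominance i (rho u v : R) : (i <= q)%N -> 0 < rho ->
  0 <= u < 1 -> 0 <= v < 1 ->
  u * (1 - v) + v * (1 - u) < (1 - u) * (1 - v) ->
  ((0 < i)%N -> r_ i / rho <= u) -> ((i < q)%N -> rho / r_ i.+1 <= v) ->
  \sum_(j < n.+1 | j != k_ i :> nat) sigma j * rho ^+ j
    < sigma (k_ i) * rho ^+ k_ i.
Proof.
move=> iq rho0 u01 v01 uv1 ru rv; have kV := newton_k_mem s0 iq.
have [kn sk _] := vertexP kV.
have sk0 : 0 < sigma (k_ i) by rewrite lt_def sk (classQ_ge0 cQ).
apply: (geometric_dominance (x := fun j => sigma j * rho ^+ j)
  kn _ u01 v01 uv1) => [|j jk|j /andP[kj jn]].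
- by rewrite mulr_gt0 ?exprn_gt0.
- have i0 : (0 < i)%N.
    by case: i jk {iq ru rv kV kn sk sk0} => //; rewrite newton_k0.
  have iq' : (0 < i <= q)%N by rewrite i0.
  have jn := leq_trans (ltnW jk) kn.
  have [_ r0 _ /(_ j jn)[/(_ (ltnW jk)) sj _]] := edge iq'.
  apply: le_trans (ler_wpM2r (exprn_ge0 j (ltW rho0)) sj) _.
  rewrite -!mulrA ler_pM2l //; rewrite -{2}(subnK (ltnW jk)) exprD mulrAC.
  rewrite ler_pM2r ?exprn_gt0 // -exprMn lerXn2r ?nnegrE ?(ltW r0) //.
    by rewrite mulr_ge0 ?(ltW rho0) //; case/andP: u01.
  by rewrite mulrC -ler_pdivrMr // ru.
- have i_q : (i < q)%N.
    rewrite ltn_neqAle iq andbT; apply: contraTneq kj => ->.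
    by rewrite newton_kq // -leqNgt.
  have iq' : (0 < i.+1 <= q)%N by [].
  have [_ r0 _ /(_ j jn)[_ /(_ (ltnW kj)) sj]] := edge iq'.
  rewrite /= in sj; move: (rv i_q); rewrite ler_pdivrMr // => rhov.
  have v0 : 0 <= v by case/andP: v01.
  rewrite -[in rho ^+ j](subnK (ltnW kj)) exprD mulrA [leRHS]mulrAC.
  rewrite ler_pM2r ?exprn_gt0 //.
  apply: le_trans (_ : sigma j * (v * r_ i.+1) ^+ (j - k_ i) <= _).
    rewrite ler_wpM2l ?(classQ_ge0 cQ) // lerXn2r ?nnegrE ?(ltW rho0) //.
    by rewrite mulr_ge0 // ltW.
  by rewrite exprMn mulrCA [leRHS]mulrC ler_wpM2l ?exprn_ge0.
Qed.

Lemma count_eigenvalues_between i j (a b : R) : (i <= j)%N -> (j <= q)%N ->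
  0 < a < b ->
  \sum_(l < n.+1 | l != k_ i :> nat) sigma l * a ^+ l < sigma (k_ i) * a ^+ k_ i ->
  \sum_(l < n.+1 | l != k_ j :> nat) sigma l * b ^+ l < sigma (k_ j) * b ^+ k_ j ->
  count (annulus a b) eigs = (m * (k_ j - k_ i))%N.
Proof.
move=> ij jq /andP[a0 ab] doma domb; have b0 := lt_trans a0 ab.
have [kin _ _] := vertexP (newton_k_mem s0 (leq_trans ij jq)).
have [kjn _ _] := vertexP (newton_k_mem s0 jq).
have [_ ca] := pellet_unitary cQ kin a0 doma.
have [allb cb] := pellet_unitary cQ kjn b0 domb.
by have := count_annulus ab allb; rewrite ca cb mulnBr => <-; rewrite addKn.
Qed.

End Annuli.

Theorem theorem2p6 (R : realType) :
  exists f g : R,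
    [/\ 1211%:R / 100%:R < f < 1212%:R / 100%:R,
        4371%:R / 1000%:R < g < 4372%:R / 1000%:R &
        forall (m n : nat) (sigma : nat -> R) (Q : nat -> 'M[R[i]]_m),
          classQ n sigma Q ->
          let A := matpoly n (scaled_coef sigma Q) in
          let q := newton_q n sigma in
          let r := newton_r n sigma in
          let g' := 2%:R + Num.sqrt 2%:R in
          let eigs_in a b := count (annulus a b) (eigenvalues A) in
          [/\ forall i : nat, (1 < i < q)%N ->
                r i.-1 / r i < 1 / f -> r i / r i.+1 < 1 / f ->
                eigs_in (r i / g) (r i * g) = (m * newton_m n sigma i)%N,
              forall i : nat, i = 1%N -> (i <= q)%N ->
                ((i < q)%N -> r i / r i.+1 < 1 / f) ->
                eigs_in (r i / g') (r i * g) = (m * newton_m n sigma i)%N &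
              forall i : nat, i = q -> (1 <= i)%N ->
                ((1 < i)%N -> r i.-1 / r i < 1 / f) ->
                eigs_in (r i / g) (r i * g') = (m * newton_m n sigma i)%N]].
Proof.
pose f : R := 2423 / 200; pose g : R := 8743 / 2000.
exists f, g; split; [by apply/andP; split; rewrite /f; lra |
  by apply/andP; split; rewrite /g; lra |].
(* Only these consequences of the choice of the constants matter. *)
have [f0 g1 g4 gf] : [/\ 0 < f, 1 < g, g^-1 <= 1 / 4 & g / f <= 3 / 8].
  by rewrite /f /g; split; lra.
clearbody f g; have g0 : 0 < g := lt_trans ltr01 g1.
move=> m n sigma Q cQ A q r g' eigs_in.
have s0 := classQ_sigma0 cQ; have sn := classQ_sigman cQ.
have r0 i : (0 < i <= q)%N -> 0 < r i.
  by move=> /(newton_edge (classQ_ge0 cQ) s0 sn)[].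
have g'3 : 3 <= g'.
  rewrite /g'; suff : 1 <= Num.sqrt 2 :> R by lra.
  by rewrite -[leLHS]sqrtr1 ler_wsqrtr // ler1n.
have g'1 : 1 < g' by apply: lt_le_trans g'3; rewrite ltr1n.
have g'0 : 0 < g' := lt_trans ltr01 g'1.
have g'3' : g'^-1 <= 1 / 3 by rewrite mul1r lef_pV2 ?posrE.
have lt_radii i G H : (0 < i <= q)%N -> 1 < G -> 1 < H -> 0 < r i / G < r i * H.
  move=> /r0 ri G1 H1; have G0 := lt_trans ltr01 G1.
  rewrite divr_gt0 //= ltr_pM2l //; apply: lt_trans H1.
  by rewrite invf_lt1.
(* The circles bounding the annulus of the [i]-th edge: dominance holds with
   ratios 1/4 towards that edge and g/f <= 3/8 towards the neighbouring one. *)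
have inner i : (0 < i <= q)%N -> ((1 < i)%N -> r i.-1 / r i < 1 / f) ->
    \sum_(j < n.+1 | j != newton_k n sigma i.-1 :> nat) sigma j * (r i / g) ^+ j
    < sigma (newton_k n sigma i.-1) * (r i / g) ^+ newton_k n sigma i.-1.
  move=> i0q lt_f; have ri := r0 i i0q; case/andP: i0q => i0 iq.
  apply: (newton_dominance cQ (u := 3 / 8) (v := 1 / 4)) => //;
    rewrite ?divr_gt0 //; try lra.
  - exact: leq_trans (leq_pred i) iq.
  - rewrite ltn_predRL => i1; apply: le_trans gf.
    rewrite invf_div mulrA mulrAC [g / f]mulrC -[f^-1]mul1r.
    by rewrite ler_pM2r // ltW // lt_f.
  - by rewrite prednK // => _; rewrite mulrAC divff ?gt_eqF // [leLHS]mul1r.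
have outer i : (0 < i <= q)%N -> ((i < q)%N -> r i / r i.+1 < 1 / f) ->
    \sum_(j < n.+1 | j != newton_k n sigma i :> nat) sigma j * (r i * g) ^+ j
    < sigma (newton_k n sigma i) * (r i * g) ^+ newton_k n sigma i.
  move=> i0q lt_f; have ri := r0 i i0q; case/andP: i0q => i0 iq.
  apply: (newton_dominance cQ (u := 1 / 4) (v := 3 / 8)) => //;
    rewrite ?mulr_gt0 //; try lra.
  - by move=> _; rewrite invfM mulrA divff ?gt_eqF // [leLHS]mul1r.
  - move=> /lt_f lt_r; apply: le_trans gf.
    by rewrite mulrAC [g / f]mulrC -[f^-1]mul1r ler_pM2r // ltW.
split=> i.
- move=> /andP[i1 iq] lt1 lt2; have i0 := ltnW i1; have iq' := ltnW iq.
  rewrite /eigs_in (count_eigenvalues_between cQ (leq_pred i) iq') //.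
  + by apply: lt_radii; rewrite ?i0.
  + by apply: inner; rewrite ?i0.
  + by apply: outer; rewrite ?i0.
- move=> -> q1 lt2; have r1 := r0 1%N q1.
  rewrite /eigs_in (count_eigenvalues_between cQ (leq0n 1) q1) //.
  + exact: lt_radii.
  + (* Below the first edge only higher powers compete with [sigma 0]. *)
    apply: (newton_dominance cQ (u := 0) (v := 1 / 3)) => //;
      rewrite ?divr_gt0 //; try lra.
    by move=> _; rewrite mulrAC divff ?gt_eqF // [leLHS]mul1r.
  + exact: outer.
- move=> iE i0 lt1; have iq : (i <= q)%N by rewrite iE.
  have ri : 0 < r i by apply: r0; rewrite i0.
  rewrite /eigs_in (count_eigenvalues_between cQ (leq_pred i) iq) //.
  + by apply: lt_radii; rewrite ?i0.
  + by apply: inner; rewrite ?i0.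
  + (* Above the last edge only lower powers compete with [sigma n]. *)
    apply: (newton_dominance cQ (u := 1 / 3) (v := 0)) => //;
      rewrite ?mulr_gt0 //; try lra.
    * by move=> _; rewrite invfM mulrA divff ?gt_eqF // [leLHS]mul1r.
    * by rewrite iE ltnn.
Qed.
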